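(* The $p$-\textsc{Difr} problem on an $n$-vertex directed tree (a directed graph whose underlying undirected graph is a tree, with arbitrary edge orientations) can be solved in time $\mathcal{O}(n^4)$.
   Context: Let $G=(V,E)$ be a directed graph with coloring $f:V\to\{B,R\}$ (blue/red). For $v\in V$, $N^+(v)$ is its out-neighborhood and $b_v$ the number of blue out-neighbors. The $p$-deficiency is $\mathit{def}_p(v)=\max\{0,\lceil p|N^+(v)|\rceil-b_v\}$; $v$ is under $p$-illusion if $\mathit{def}_p(v)>0$. $p$-\textsc{Difr}: given $G,f$, an integer $k\ge0$ and rational $p\in[0,1]$, decide whether there is a coloring $f'$ differing from $f$ on at most $k$ vertices such that no vertex is under $p$-illusion under $f'$. *)

(* Defs.v *)
From HB Require Import structures.
From mathcomp Require Import all_boot all_order all_algebra.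

Set Implicit Arguments.
Unset Strict Implicit.
Unset Printing Implicit Defensive.

Import Order.TTheory GRing.Theory Num.Theory.

Variant color := Blue | Red.

Definition is_blue (c : color) : bool := if c is Blue then true else false.
Definition color_of_bool (b : bool) : color := if b then Blue else Red.

Lemma is_blueK : cancel is_blue color_of_bool.
Proof. by case. Qed.

HB.instance Definition _ := Equality.copy color (can_type is_blueK).

(* A directed graph on a finite vertex type V is its arc relation:
   arc u v means that there is an arc from u to v. *)
Section Difr.
Variables (V : finType) (arc : rel V).
Implicit Types (f : {ffun V -> color}) (p : rat) (v : V).

Definition out_nbhd v : {set V} := [set u | arc v u].

Definition blue_out f v : nat := #|[set u in out_nbhd v | f u == Blue]|.

Definition deficiency p f v : int :=
  Num.max 0%R (Num.ceil (p * #|out_nbhd v|%:R)%R - (blue_out f v)%:Z)%R.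

Definition under_illusion p f v : bool := (0 < deficiency p f v)%R.

Definition Difr f (k : nat) p : Prop :=
  exists f' : {ffun V -> color},
    #|[set v | f' v != f v]| <= k /\ forall v, ~~ under_illusion p f' v.

Definition underlying : rel V := [rel u v | arc u v || arc v u].

End Difr.

(* Finite simple graphs are symmetric irreflexive relations. In such a graph a
   cycle is a cyclic sequence of at least 3 pairwise distinct vertices. *)
Definition is_tree (V : finType) (g : rel V) : Prop :=
  [/\ 0 < #|V|,
      symmetric g /\ irreflexive g,
      forall u v : V, connect g u v &
      forall c : seq V, 2 < size c -> ~ ucycle g c].

Definition directed_tree (V : finType) (arc : rel V) : Prop :=
  is_tree (underlying arc).

(* Random access machine of Cook and Reckhow, with natural numbers in its
   registers X_0, X_1, ... and unit cost for each instruction. There is no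
   multiplication, so that the unit cost measure is a reasonable one. *)
Variant instr :=
  | Const of nat & nat        (* Const i c    X_i := c *)
  | Add of nat & nat & nat    (* Add i j l    X_i := X_j + X_l *)
  | Sub of nat & nat & nat    (* Sub i j l    X_i := X_j - X_l, truncated at 0 *)
  | Fetch of nat & nat        (* Fetch i j    X_i := X_(X_j) *)
  | Store of nat & nat        (* Store i j    X_(X_i) := X_j *)
  | Jump of nat & nat         (* Jump j q     if X_j > 0 go to instruction q *)
  | Read of nat.              (* Read i       X_i := next input number,
                                              or 0 if there is none left *)

Definition program := seq instr.

Record config := Config { pc : nat; reg : nat -> nat; tape : seq nat }.

Definition upd (m : nat -> nat) (i x : nat) : nat -> nat :=
  fun a => if a == i then x else m a.

Definition exec (c : instr) (s : config) : config :=
  let: Config q m t := s in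
  match c with
  | Const i x => Config q.+1 (upd m i x) t
  | Add i j l => Config q.+1 (upd m i (m j + m l)) t
  | Sub i j l => Config q.+1 (upd m i (m j - m l)) t
  | Fetch i j => Config q.+1 (upd m i (m (m j))) t
  | Store i j => Config q.+1 (upd m (m i) (m j)) t
  | Jump j q' => Config (if 0 < m j then q' else q.+1) m t
  | Read i => Config q.+1 (upd m i (head 0 t)) (behead t)
  end.

Definition halted (P : program) (s : config) : bool := size P <= pc s.

(* A halted configuration is a fixed point of step. Hence P halts within T
   instructions from s if and only if iter T (step P) s is halted. *)
Definition step (P : program) (s : config) : config :=
  if onth P (pc s) is Some c then exec c s else s.

Definition init (input : seq nat) : config := Config 0 (fun=> 0) input.

(* Within T instructions, P halts on the input with the truth value (1 or 0)
   of A in register X_0. *)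
Definition decides_within (P : program) (input : seq nat) (T : nat)
    (A : Prop) : Prop :=
  let s := iter T (step P) (init input) in
  halted P s /\ (A /\ reg s 0 = 1 \/ ~ A /\ reg s 0 = 0).

(* The input tape holds n, k, the numerator and denominator of p, the colors
   (1 for blue, 0 for red) of the n vertices, and the adjacency matrix row by
   row. For p >= 0 the absolute values lose nothing. *)
Definition encode (n : nat) (arc : rel 'I_n) (f : {ffun 'I_n -> color})
    (k : nat) (p : rat) : seq nat :=
  [:: n; k; absz (numq p); absz (denq p)]
  ++ [seq nat_of_bool (f v == Blue) | v <- enum 'I_n]
  ++ [seq nat_of_bool (arc u v) | u <- enum 'I_n, v <- enum 'I_n].

Definition bigO (T g : nat -> nat) : Prop :=
  exists C n0 : nat, forall n, n0 <= n -> T n <= C * g n.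

(* Main.v *)
Require Import Defs.
From HB Require Import structures.
From mathcomp Require Import all_boot all_order all_algebra.
From mathcomp Require Import zify.
(* Makes [Sub] denote the machine instruction again, not the subtype constructor. *)
Import Defs.

Set Implicit Arguments.
Unset Strict Implicit.
Unset Printing Implicit Defensive.

(** Only recoloring red vertices blue can help, and this always succeeds as
    p <= 1; a greedy leaf elimination finds the least number of recolorings.
    Repeatedly eliminate a vertex v with at most one open (not yet eliminated)
    neighbor: as long as v is under illusion, recolor a red outneighbor, taking
    the open one first. This is optimal by exchange: an eliminated outneighbor x
    of v has no open neighbor but v, so among the constraints not yet met x only
    helps v, and any solution that uses x can trade it for the vertex chosen by
    the algorithm. On the adjacency matrix, n rounds that examine every vertex
    in time O(n) eliminate the whole tree, for a total of O(n^3) steps. *)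

(** * Greedy leaf elimination *)

(** If every vertex of [U] had two neighbors in [U], paths in [U] could be extended forever, since
    returning to the path would close a cycle; this contradicts finiteness. *)
Lemma tree_has_leaf (V : finType) (g : rel V) (U : {set V}) :
  is_tree g -> U != set0 ->
  exists2 v, v \in U & #|[set u in U | g v u]| <= 1.
Proof.
move=> [_ [gsym girr] _ acyc] /set0Pn[x0 x0U].
have [/existsP[v /andP[vU vle]]|] :=
  boolP [exists v, (v \in U) && (#|[set u in U | g v u]| <= 1)].
  by exists v.
rewrite negb_exists => /forallP noleaf; exfalso.
have deg2 v : v \in U -> 1 < #|[set u in U | g v u]|.
  by move=> vU; move: (noleaf v); rewrite vU -ltnNge.
have long m : exists x p,
  [/\ path g x p, uniq (x :: p), size p = m & all [in U] (x :: p)].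
  elim: m => [|m [x [p [gp up sp Up]]]].
    by exists x0, [::]; split=> //=; rewrite x0U.
  have xU : x \in U by case/andP: Up.
  have [w [wU gxw whp]] : exists w, [/\ w \in U, g x w & w != head x p].
    have : ~~ ([set u in U | g x u] \subset [set head x p]).
      by apply: contraTN (deg2 x xU) => /subset_leq_card; rewrite cards1 -leqNgt.
    by case/subsetPn=> w; rewrite !inE => /andP[wU gxw] wh; exists w; split.
  have wx : w != x by apply: contraTneq gxw => ->; rewrite girr.
  have [wp|wnp] := boolP (w \in p); last first.
    exists w, (x :: p); split=> //=.
    - by rewrite gsym gxw.
    - by rewrite inE negb_or wx wnp.
    - by rewrite sp.
    - by rewrite wU xU; case/andP: Up.
  (* If [w] lies on the path, [x :: rcons p1 w] is a cycle; it has at least 3 vertices because [w]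
     is not the head of [p]. *)
  exfalso; move: gp up whp; case/splitPr: wp => p1 p2.
  rewrite cat_path /= => /and3P[gp1 gl _] up whp.
  apply: (acyc (x :: rcons p1 w)).
    by case: p1 whp {gp1 gl up} => [|y p1] /=; rewrite ?eqxx //= size_rcons.
  rewrite /ucycle /ucycleb /= rcons_path last_rcons rcons_path gp1 gl /= gsym gxw /=.
  by move: up; rewrite /= -cat_rcons mem_cat cat_uniq negb_or
     => /andP[/andP[-> _] /andP[-> _]].
have [x [p [_ up sp _]]] := long #|V|.
by have := max_card [in x :: p]; rewrite (card_uniqP up) /= sp ltnn.
Qed.

Section Greedy.
Variables (V : finType) (arc : rel V) (a b : nat) (B0 : {set V}).
Implicit Types (B D X : {set V}).

(** This is p |N^+(v)| <= b_v for p = a / b with the denominator cleared, so that the machine can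
    test it by additions and a comparison. *)
Definition sat B v := a * #|out_nbhd arc v| <= b * #|out_nbhd arc v :&: B|.

Definition open_nbrs D v := [set u in ~: D | underlying arc v u].

Definition valid X := B0 \subset X /\ forall v, sat X v.

(* [B] is the current set of blue vertices, [D] the set of eliminated vertices
   (the others are open), and [c] the number of recolored vertices. *)
Record greedy_inv B D c : Prop := GreedyInv {
  inv_sub : B0 \subset B;
  inv_card : #|B :\: B0| = c;
  inv_sat : forall v, v \in D -> sat B v;
  inv_leaf : forall v, v \in D -> #|open_nbrs D v| <= 1;
  inv_opt : forall X, valid X ->
    exists X', [/\ valid X', B \subset X' & #|X'| <= #|X|] }.

Lemma satS B B' v : B \subset B' -> sat B v -> sat B' v.
Proof.
move=> sBB' /leq_trans; apply; rewrite leq_mul2l.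
by rewrite subset_leq_card ?orbT // setIS.
Qed.

Lemma open_nbrsS D D' v : D \subset D' ->
  #|open_nbrs D' v| <= #|open_nbrs D v|.
Proof.
move=> sDD'; apply/subset_leq_card/subsetP=> u; rewrite !inE.
by case/andP=> uD' ->; rewrite andbT; apply: contra uD'; apply: (subsetP sDD').
Qed.

Lemma greedy_init : greedy_inv B0 set0 0.
Proof.
split=> [||v|v|X [sX vX]]; rewrite ?setDv ?cards0 ?inE //.
by exists X.
Qed.

Lemma greedy_close B D c v : greedy_inv B D c -> sat B v ->
  #|open_nbrs D v| <= 1 -> greedy_inv B (v |: D) c.
Proof.
case=> sB cB satB leafD opt satv leafv; split=> // w; rewrite !inE => /orP[/eqP->|wD] //.
- exact: satB.
- by apply: leq_trans leafv; apply/open_nbrsS/subsetUr.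
- by apply: leq_trans (leafD w wD); apply/open_nbrsS/subsetUr.
Qed.

(* Exchange: a valid superset of [B] missing [y] contains another outneighbor
   [x] of [v] outside [B]. The hypotheses force [x] into [D], so [v] is its
   only open neighbor, and trading [x] for [y] harms no constraint. *)
Lemma greedy_recolor B D c v y : greedy_inv B D c ->
  v \notin D -> #|open_nbrs D v| <= 1 -> ~~ sat B v ->
  arc v y -> y \notin B ->
  (y \in D -> forall u, u \notin D -> arc v u -> u \in B) ->
  greedy_inv (y |: B) D c.+1.
Proof.
case=> sB cB satB leafD opt vD leafv nsat vy yB prio.
have sBy : B \subset y |: B by apply: subsetUr.
split=> //.
- exact: subset_trans sB sBy.
- rewrite setDUl (setDidPl _) ?disjoints1 ?cardsU1 ?cB ?inE ?(negPf yB) ?andbF //.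
  by apply: contra yB; apply: (subsetP sB).
- by move=> w /satB; apply: satS.
move=> X /opt[X' [[sX' vX'] sBX' leX']].
have [yX'|yX'] := boolP (y \in X').
  by exists X'; split=> //; rewrite subUset sub1set yX'.
have [x xoX xB] : exists2 x, x \in out_nbhd arc v :&: X' & x \notin B.
  have : ~~ (out_nbhd arc v :&: X' \subset B).
    apply: contra nsat => sub; apply: leq_trans (vX' v) _.
    by rewrite leq_mul2l subset_leq_card ?orbT // subsetI subsetIl.
  by case/subsetPn=> x xo xB; exists x.
move: xoX; rewrite !inE => /andP[vx xX'].
have xy : x != y by apply: contraNneq yX' => <-.
(* If [y] is eliminated, [prio] puts every open outneighbor in [B]; if [y] is open, an open [x]
   would be a second open neighbor of [v]. *)
have xD : x \in D.
  apply: contraNT xB => xD; have [yD|yD] := boolP (y \in D); first exact: prio.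
  have : [set x; y] \subset open_nbrs D v.
    by rewrite subUset !sub1set !inE /underlying /= xD yD vx vy.
  by move/subset_leq_card; rewrite cards2 xy => /leq_trans/(_ leafv).
have BX : y |: B \subset y |: X' :\ x.
  by rewrite setUS // subsetD1 sBX'.
exists (y |: X' :\ x); split=> //; last first.
  apply: leq_trans leX'; rewrite cardsU1 !inE (negPf yX') andbF.
  by rewrite (cardsD1 x X') xX'.
split=> [|z]; first exact: subset_trans (subset_trans sB sBy) BX.
(* An eliminated [z] is satisfied by [B] alone, [v] loses [x] but gains [y], and any other open [z]
   has no arc to [x], whose only open neighbor is [v]. *)
have [zD|zD] := boolP (z \in D).
  by apply: satS (satB z zD); apply: subset_trans BX.
have [->|zv] := eqVneq z v.
  apply: leq_trans (vX' v) _; rewrite leq_mul2l; apply/orP; right.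
  have -> : out_nbhd arc v :&: (y |: X' :\ x) =
            y |: (out_nbhd arc v :&: X') :\ x.
    apply/setP=> w; rewrite !inE; have [->|] //= := eqVneq w y; first by rewrite vy.
    by rewrite andbCA.
  rewrite cardsU1 !inE (negPf yX') !andbF.
  by rewrite (cardsD1 x (_ :&: _)) !inE vx xX'.
have zx : ~~ arc z x.
  apply/negP=> zx; have : [set z; v] \subset open_nbrs D x.
    by rewrite subUset !sub1set !inE /underlying /= zD vD zx vx !orbT.
  by move/subset_leq_card; rewrite cards2 zv => /leq_trans/(_ (leafD x xD)).
apply: leq_trans (vX' z) _; rewrite leq_mul2l subset_leq_card ?orbT //.
apply/subsetP=> w; rewrite !inE => /andP[zw ->]; rewrite zw andbT /=.
by apply/orP; right; apply: contraNneq zx => <-.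
Qed.

Lemma greedy_optimal B c X : greedy_inv B setT c -> valid X -> c <= #|X :\: B0|.
Proof.
case=> sB <- _ _ opt vX; have [X' [[sX' _] sBX' le]] := opt X vX.
rewrite !cardsD (setIidPr sB) (setIidPr vX.1) leq_sub2r //.
by apply: leq_trans le; apply: subset_leq_card.
Qed.

End Greedy.

(** * Recolorings as sets of blue vertices *)

Section Difr_blue_sets.
Variables (V : finType) (arc : rel V) (f : {ffun V -> color}) (p : rat).
Hypothesis p01 : (0 <= p <= 1)%R.
Let a := absz (numq p).
Let b := absz (denq p).
Let B0 := [set v | f v == Blue].

Import Order.TTheory GRing.Theory Num.Theory.

Lemma num_le_den : a <= b.
Proof.
have /andP[p0 p1] := p01; rewrite -lez_nat /a /b (gez0_abs (denq_ge0 p)).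
rewrite gez0_abs ?numq_ge0 // -(ler_int rat).
have := p1; rewrite -{1}(divq_num_den p) ler_pdivrMr ?mul1r //.
by rewrite ltr0z denq_gt0.
Qed.

(** An integer bounds the ceiling of p d exactly when it bounds p d; multiplying by the denominator
    gives [sat]. *)
Lemma illusion_sat (g : {ffun V -> color}) v :
  ~~ under_illusion arc p g v = sat arc a b [set u | g u == Blue] v.
Proof.
have /andP[p0 p1] := p01.
have blueE : blue_out arc g v = #|out_nbhd arc v :&: [set u | g u == Blue]|.
  by apply: eq_card => u; rewrite !inE.
rewrite /under_illusion /deficiency /sat blueE -leNgt ge_max lexx /= subr_le0.
set d := #|out_nbhd _ _|; set e := #|_ :&: _|.
have -> : (Num.ceil (p * d%:R) <= e%:Z)%R = (p * d%:R <= (e%:Z)%:~R)%R.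
  by rewrite ceil_le_int.
rewrite -{1}(divq_num_den p) mulrAC ler_pdivrMr ?ltr0z ?denq_gt0 //.
rewrite -lez_nat !PoszM /a /b (gez0_abs (denq_ge0 p)) gez0_abs ?numq_ge0 //.
by rewrite -(ler_int rat) !intrM [X in (_ <= X)%R]mulrC.
Qed.

(** A solution [g] stays one after undoing its changes from blue to red, and the resulting valid set
    exceeds [B0] by at most the number of changes. Conversely, [B] itself gives a solution. *)
Lemma greedy_decides B c k :
  greedy_inv arc a b B0 B setT c -> Difr arc f k p <-> c <= k.
Proof.
move=> inv; split=> [[g [gk gsat]]|ck].
  have vX : valid arc a b B0 ([set u | g u == Blue] :|: B0).
    split=> [|v]; first exact: subsetUr.
    by apply: satS (subsetUl _ _) _; rewrite -illusion_sat.
  apply: leq_trans (greedy_optimal inv vX) (leq_trans _ gk).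
  apply/subset_leq_card/subsetP=> u; rewrite !inE => /andP[fu].
  by rewrite (negPf fu) orbF => /eqP->; rewrite eq_sym.
exists [ffun u => color_of_bool (u \in B)].
have blueB : [set u | [ffun u => color_of_bool (u \in B)] u == Blue] = B.
  by apply/setP=> u; rewrite !inE ffunE; case: (u \in B).
split=> [|v]; last by rewrite illusion_sat blueB (inv_sat inv) ?inE.
apply: leq_trans ck; rewrite -(inv_card inv).
apply/subset_leq_card/subsetP=> u; rewrite !inE ffunE.
have := subsetP (inv_sub inv) u; rewrite inE.
by case: (f u); case: (u \in B) => // /(_ isT).
Qed.

End Difr_blue_sets.

(** * Structured programs and their running time *)

(** A [Jump] tests positivity: [Unless j c] skips [c] if X_j > 0, and [DoWhile c j] repeats [c] as
    long as X_j > 0. *)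
Inductive cmd :=
  | Block of seq instr
  | Seq of cmd & cmd
  | Unless of nat & cmd
  | DoWhile of cmd & nat.

(* Jump targets are absolute, hence the address [q] of the first instruction. *)
Fixpoint compile (q : nat) (c : cmd) : seq instr :=
  match c with
  | Block s => s
  | Seq c1 c2 => compile q c1 ++ compile (q + size (compile q c1)) c2
  | Unless j c =>
      Jump j (q.+1 + size (compile q.+1 c)) :: compile q.+1 c
  | DoWhile c j => rcons (compile q c) (Jump j q)
  end.

Definition assertion := (nat -> nat) -> seq nat -> Prop.

Definition code_at (P : program) q (s : seq instr) :=
  exists p1 p2, size p1 = q /\ P = p1 ++ s ++ p2.

Lemma code_at_cat P q s1 s2 : code_at P q (s1 ++ s2) ->
  code_at P q s1 /\ code_at P (q + size s1) s2.
Proof.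
case=> p1 [p2 [<- ->]]; split.
  by exists p1, (s2 ++ p2); rewrite -!catA.
by exists (p1 ++ s1), p2; rewrite size_cat -!catA.
Qed.

Lemma step_at P q i m t : code_at P q [:: i] ->
  step P (Config q m t) = exec i (Config q m t).
Proof. by case=> p1 [p2 [<- ->]]; rewrite /step /= onth_cat ltnn subnn. Qed.

(* From the first instruction of [c], the code of [c] is left at its end after
   at most [T] steps, in a state that satisfies [Q]. *)
Definition runs (c : cmd) m t (T : nat) (Q : assertion) :=
  forall P q, code_at P q (compile q c) ->
  exists T' m' t', [/\ T' <= T,
    iter T' (step P) (Config q m t) = Config (q + size (compile q c)) m' t' &
    Q m' t'].

Lemma runs_weaken c m t T (Q Q' : assertion) :
  (forall m t, Q m t -> Q' m t) -> runs c m t T Q -> runs c m t T Q'.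
Proof.
move=> QQ' r P q cP; have [T' [m' [t' [? ? ?]]]] := r P q cP.
by exists T', m', t'; split; auto.
Qed.

(** Keeping the rest of the budget inside the postcondition lets a program be executed symbolically
    from left to right. *)
Lemma runs_seq T1 c1 c2 m t T Q : T1 <= T ->
  runs c1 m t T1 (fun m' t' => runs c2 m' t' (T - T1) Q) ->
  runs (Seq c1 c2) m t T Q.
Proof.
move=> leT r1 P q /= /code_at_cat[cP1 cP2].
have [k1 [m1 [t1 [lek1 it1 r2]]]] := r1 P q cP1.
have [k2 [m2 [t2 [lek2 it2 Q2]]]] := r2 P _ cP2.
exists (k2 + k1), m2, t2; split=> //; first by lia.
by rewrite iterD it1 it2 size_cat addnA.
Qed.

Lemma runs_unless j c m t T (Q : assertion) : 0 < T ->
  (m j = 0 -> runs c m t T.-1 Q) -> (0 < m j -> Q m t) ->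
  runs (Unless j c) m t T Q.
Proof.
case: T => // T _ r0 r1 P q /= cP.
have /(code_at_cat (s1 := [:: _]))[cP1] := cP; rewrite addn1 => cP2.
have [m0|mpos] := posnP (m j); last first.
  exists 1, m, t; split=> //=; last exact: r1.
  by rewrite (step_at _ _ cP1) /= mpos addnS addSn.
have [k2 [m2 [t2 [lek2 it2 Q2]]]] := r0 m0 P q.+1 cP2.
exists k2.+1, m2, t2; split=> //.
by rewrite iterSr (step_at _ _ cP1) /= m0 it2 addnS addSn.
Qed.

(** The value required of the tested register forces exactly [N] iterations; the extra unit per
    iteration pays for the jump. *)
Lemma runs_dowhile N T' (I : nat -> assertion) j c m t T (Q : assertion) :
  0 < N -> N * T'.+1 <= T -> I 0 m t ->
  (forall i m t, i < N -> I i m t ->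
     runs c m t T' (fun m' t' => I i.+1 m' t' /\ m' j = N - i.+1)) ->
  (forall m t, I N m t -> Q m t) ->
  runs (DoWhile c j) m t T Q.
Proof.
move=> N0 leT I0 body IQ P q /=; rewrite -cats1 => cP.
have [cP1 cP2] := code_at_cat cP.
suff loop d : forall i m t, i + d.+1 = N -> I i m t -> exists k m' t',
    [/\ k <= d.+1 * T'.+1,
      iter k (step P) (Config q m t) = Config (q + size (compile q c)).+1 m' t' &
      Q m' t'].
  have [k [m' [t' [lek itk Qk]]]] := loop N.-1 0 m t ltac:(lia) I0.
  exists k, m', t'; split=> //; last by rewrite itk size_cat /= addn1 addnS.
  by apply: leq_trans lek (leq_trans _ leT); rewrite prednK.
elim: d => [|d IH] i m0 t0 Ni Ii.
  have [k [m1 [t1 [lek itk [I1 m1j]]]]] := body i m0 t0 ltac:(lia) Ii P q cP1.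
  exists k.+1, m1, t1; split; first by lia.
    by rewrite iterS itk (step_at _ _ cP2) /= m1j (_ : N - i.+1 = 0) //; lia.
  by apply: IQ; rewrite -Ni addn1.
have [k [m1 [t1 [lek itk [I1 m1j]]]]] := body i m0 t0 ltac:(lia) Ii P q cP1.
have [k2 [m2 [t2 [lek2 itk2 Q2]]]] := IH i.+1 m1 t1 ltac:(lia) I1.
exists (k2 + k.+1), m2, t2; split=> //; first by rewrite mulSn; lia.
rewrite iterD iterS itk (step_at _ _ cP2) /= m1j.
by rewrite (_ : 0 < N - i.+1) //; lia.
Qed.

(* The quantified equations name the stored values, so that nested updates do
   not blow up under symbolic execution. *)
Fixpoint wp (s : seq instr) (Q : assertion) (m : nat -> nat) (t : seq nat) :=
  match s with
  | [::] => Q m t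
  | Const i x :: s => wp s Q (upd m i x) t
  | Add i j l :: s => forall x, x = m j + m l -> wp s Q (upd m i x) t
  | Sub i j l :: s => forall x, x = m j - m l -> wp s Q (upd m i x) t
  | Fetch i j :: s => forall x, x = m (m j) -> wp s Q (upd m i x) t
  | Store i j :: s => forall y x, y = m i -> x = m j -> wp s Q (upd m y x) t
  | Jump _ _ :: s => False
  | Read i :: s => wp s Q (upd m i (head 0 t)) (behead t)
  end.

Lemma runs_block s m t T Q : size s <= T -> wp s Q m t ->
  runs (Block s) m t T Q.
Proof.
move=> leT wps P q /= cP.
suff [m' [t' [it Q']]] : exists m' t',
    iter (size s) (step P) (Config q m t) = Config (q + size s) m' t' /\ Q m' t'.
  by exists (size s), m', t'.
elim: s q m t cP wps {T leT} => [|i s IH] q m t cP wps.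
  by exists m, t; rewrite addn0.
have /(code_at_cat (s1 := [:: _]))[cP1] := cP; rewrite addn1 => cP2.
case: i wps cP1 {cP} => [i x|i j l|i j l|i j|i j|j l|i] //= wps cP1;
  rewrite -/(iter _ (step P) _) -iterS iterSr (step_at _ _ cP1) /= -addSnnS;
  by apply: IH => //; apply: wps.
Qed.

Lemma upd_ne m i x a : a != i -> upd m i x a = m a.
Proof. by rewrite /upd => /negPf->. Qed.

(** * The decision program *)

(* Register usage: X_0 = 0 until the end, X_1 = 1, X_2 .. X_5 = n, k and the
   fraction a / b; X_6 and X_7 point to the flags of the eliminated vertices and
   to the adjacency matrix; X_8, X_9, X_10 count down the loops over rounds,
   over v and over u; X_11, X_12, X_13 point to row v, column v and the flag of
   v; X_14 counts the recolored vertices. The colors start at address 30. *)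
Definition read_input : cmd :=
  Seq (Block [:: Const 1 1; Read 2; Read 3; Read 4; Read 5; Const 6 30;
                 Add 8 2 1])
 (Seq (DoWhile
        (Seq (Block [:: Add 9 2 0])
        (Seq (DoWhile
               (Block [:: Read 10; Store 6 10; Add 6 6 1; Sub 9 9 1]) 9)
             (Block [:: Sub 8 8 1]))) 8)
      (Block [:: Const 7 30; Add 7 7 2])).

(** Two subtractions from 1 turn the sum of the two arc bits into their disjunction; truncated
    subtraction of the flag then leaves 1 exactly for an open neighbor. *)
Definition survey_step : cmd :=
  Seq (Block [:: Fetch 22 18; Fetch 23 19; Add 23 22 23; Sub 23 1 23;
                 Sub 23 1 23; Fetch 24 21; Sub 23 23 24; Add 17 17 23;
                 Sub 22 1 22])
 (Seq (Unless 22
        (Seq (Block [:: Add 15 15 4; Fetch 23 20; Sub 23 1 23])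
             (Unless 23 (Block [:: Add 16 16 5]))))
      (Block [:: Add 18 18 1; Add 19 19 2; Add 20 20 1; Add 21 21 1;
                 Sub 10 10 1])).

(* Sets X_15 = a |N^+(v)|, X_16 = b |N^+(v) & B|, and X_17 to the number of
   open neighbors of v. *)
Definition survey : cmd :=
  Seq (Block [:: Const 15 0; Const 16 0; Const 17 0; Add 10 2 0; Add 18 11 0;
                 Add 19 12 0; Const 20 30; Add 21 6 0])
      (DoWhile survey_step 10).

(** X_22 sums four numbers, each zero exactly if one condition for recoloring holds: u is an
    outneighbor, u is red, u is open or X_25 = 1, and v is unsatisfied. *)
Definition recolor_step : cmd :=
  Seq (Block [:: Fetch 22 18; Sub 22 1 22; Fetch 23 20; Add 22 22 23;
                 Fetch 24 21; Sub 24 24 25; Add 22 22 24;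
                 Sub 23 15 16; Sub 23 1 23; Add 22 22 23])
 (Seq (Unless 22 (Block [:: Store 20 1; Add 16 16 5; Add 14 14 1]))
      (Block [:: Add 18 18 1; Add 20 20 1; Add 21 21 1; Sub 10 10 1])).

(* While v is not satisfied, recolors its red outneighbors: only the open ones
   if X_25 = 0, and all of them if X_25 = 1. *)
Definition recolor : cmd :=
  Seq (Block [:: Add 10 2 0; Add 18 11 0; Const 20 30; Add 21 6 0])
      (DoWhile recolor_step 10).

(** X_22 becomes 0 exactly if v is open with at most one open neighbor. The first pass of [recolor]
    gives priority to an open outneighbor. *)
Definition visit : cmd :=
  Seq survey
 (Seq (Block [:: Fetch 22 13; Sub 17 17 1; Add 22 22 17])
 (Seq (Unless 22
        (Seq (Block [:: Const 25 0]) (Seq recolor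
        (Seq (Block [:: Const 25 1]) (Seq recolor
             (Block [:: Store 13 1]))))))
      (Block [:: Add 11 11 2; Add 12 12 1; Add 13 13 1; Sub 9 9 1]))).

Definition round : cmd :=
  Seq (Block [:: Add 9 2 0; Add 11 7 0; Add 12 7 0; Add 13 6 0])
 (Seq (DoWhile visit 9)
      (Block [:: Sub 8 8 1])).

(** At the end X_14 holds the truncated difference c - k, so 1 - X_14 is the truth value of c <=
    k. *)
Definition difr_cmd : cmd :=
  Seq read_input
 (Seq (Block [:: Add 8 2 0])
 (Seq (DoWhile round 8)
      (Block [:: Sub 14 14 3; Sub 0 1 14]))).

Arguments upd m i x a /.

(** * Partial counts in the loop over the vertices *)

Section Counting.
Variable n : nat.
Implicit Types (P : pred 'I_n).

Definition count_below P i := #|[set u : 'I_n | P u & u < i]|.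

Lemma count_below0 P : count_below P 0 = 0.
Proof. by apply/eqP; rewrite cards_eq0; apply/eqP/setP=> u; rewrite !inE andbF. Qed.

Lemma count_belowS P (u : 'I_n) : count_below P u.+1 = count_below P u + P u.
Proof.
rewrite /count_below; have [Pu|nPu] := boolP (P u).
  rewrite (cardsD1 u) !inE Pu ltnSn addnC; congr addn; apply: eq_card => w.
  by rewrite !inE ltnS -val_eqE ltn_neqAle; case: (P w); rewrite ?andbF.
rewrite addn0; apply: eq_card => w; rewrite !inE ltnS leq_eqVlt.
by have [/val_inj->|] := eqVneq (val w) u; rewrite ?(negPf nPu).
Qed.

Lemma count_belown P : count_below P n = #|[set u | P u]|.
Proof. by apply: eq_card => u; rewrite !inE ltn_ord andbT. Qed.

End Counting.

(** * Correctness and running time of the program *)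

Section Correctness.
Variables (n : nat) (arc : rel 'I_n) (k a b : nat) (B0 : {set 'I_n}).
Hypotheses (n_gt0 : 0 < n) (le_ab : a <= b).
Hypothesis arc_tree : is_tree (underlying arc).
Implicit Types (B D : {set 'I_n}) (v u : 'I_n) (m : nat -> nat) (F : bool).

(** Colors, matrix and flags lie in consecutive blocks from address 30 on; addresses 8 to 29 are
    left free for loop counters, pointers and scratch values. *)
Record core B D m : Prop := Core {
  core0 : m 0 = 0; core1 : m 1 = 1; core2 : m 2 = n; core3 : m 3 = k;
  core4 : m 4 = a; core5 : m 5 = b; core6 : m 6 = 30 + n + n * n;
  core7 : m 7 = 30 + n;
  core_col : forall u, m (30 + u) = (u \in B);
  core_arc : forall v u, m (30 + n + v * n + u) = arc v u;
  core_done : forall u, m (30 + n + n * n + u) = (u \in D) }.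

Record vctx (r i : nat) m : Prop := Vctx {
  vctx8 : m 8 = r; vctx9 : m 9 = n - i; vctx11 : m 11 = 30 + n + i * n;
  vctx12 : m 12 = 30 + n + i; vctx13 : m 13 = 30 + n + n * n + i }.

Lemma core_upd B D m i x : 7 < i < 30 -> core B D m -> core B D (upd m i x).
Proof.
by move=> ilt [*]; split=> *; rewrite upd_ne //; lia.
Qed.

Lemma vctx_upd r i m j x : (j == 10) || (13 < j < 30) -> vctx r i m ->
  vctx r i (upd m j x).
Proof. by move=> jlt [*]; split=> *; rewrite upd_ne //; lia. Qed.

Lemma mx_index_lt v u : v * n + u < n * n.
Proof. have := ltn_ord v; have := ltn_ord u; nia. Qed.

Lemma core_color B D m v : core B D m -> core (v |: B) D (upd m (30 + v) 1).
Proof.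
have vn := ltn_ord v; case=> *; split=> *; try by rewrite upd_ne //; lia.
by rewrite /upd eqn_add2l inE in_set1 val_eqE; case: eqP.
Qed.

Lemma core_flag B D m v : core B D m ->
  core B (v |: D) (upd m (30 + n + n * n + v) 1).
Proof.
case=> ? ? ? ? ? ? ? ? col mx flag; split=> [||||||||w|w u|w];
  try by rewrite upd_ne //; lia.
- by rewrite upd_ne //; have := ltn_ord w; lia.
- by rewrite upd_ne //; have := mx_index_lt w u; lia.
by rewrite /upd eqn_add2l inE in_set1 val_eqE; case: eqP.
Qed.

Record uctx v (i : nat) m : Prop := Uctx {
  uctx10 : m 10 = n - i; uctx18 : m 18 = 30 + n + v * n + i;
  uctx20 : m 20 = 30 + i; uctx21 : m 21 = 30 + n + n * n + i }.

Lemma uctx_upd v i m j x : (j < 10) || (10 < j < 18) || (21 < j) || (j == 19) ->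
  uctx v i m -> uctx v i (upd m j x).
Proof. by move=> jlt [*]; split=> *; rewrite upd_ne //; lia. Qed.

Lemma survey_step_runs B D r v u c x y z m t :
  core B D m -> vctx r v m -> uctx v u m -> m 14 = c ->
  m 19 = 30 + n + u * n + v -> m 15 = x -> m 16 = y -> m 17 = z ->
  runs survey_step m t 29 (fun m t =>
    [/\ core B D m, vctx r v m, uctx v u.+1 m, m 14 = c &
    [/\ m 19 = 30 + n + u.+1 * n + v, m 15 = x + a * arc v u,
        m 16 = y + b * (arc v u && (u \in B)) &
        m 17 = z + ((u \notin D) && underlying arc v u)]]).
Proof.
move=> cm vm um m14 m19 m15 m16 m17.
apply: (@runs_seq 9) => //; apply: runs_block => //=.
move=> y1; rewrite (uctx18 um) (core_arc cm) => F1.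
move=> y2; rewrite m19 /= (core_arc cm) (core1 cm) m17 => F2.
move=> y3 F3 y4 F4 y5 F5.
move=> y6; rewrite (uctx21 um) /= (core_done cm) => F6.
move=> y7 F7 y8 F8 y9 F9.
have {F2 F3 F4 F5 F6 F7}F8 :
    y8 = z + ((u \notin D) && underlying arc v u).
  rewrite F8 F7 F6 F5 F4 F3 F2 F1 /underlying /=.
  by case: (arc v u); case: (arc u v); case: (u \in D).
have {F1} F9 : y9 = ~~ arc v u by rewrite F9 F1; case: (arc v u).
(* The memory is replaced by an opaque one with the facts needed below, so that updates do not pile
   up. *)
set m' := upd _ _ _.
have cm' : core B D m' by do !apply: core_upd => //.
have vm' : vctx r v m' by do !apply: vctx_upd => //.
have um' : uctx v u m' by do !apply: uctx_upd => //.
have : [/\ m' 14 = c, m' 15 = x, m' 16 = y, m' 17 = y8 & m' 22 = y9] by [].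
have : m' 19 = 30 + n + u * n + v by [].
move: (m') cm' vm' um' => {cm vm um m14 m19 m15 m16 m17 m'}m cm vm um m19.
case=> m14 m15 m16 m17 m22.
apply: (@runs_seq 10) => //.
apply: (@runs_weaken _ _ _ _ (fun m t =>
    [/\ core B D m, vctx r v m, uctx v u m, m 14 = c &
    [/\ m 19 = 30 + n + u * n + v, m 15 = x + a * arc v u,
        m 16 = y + b * (arc v u && (u \in B)) & m 17 = y8]])).
  move=> {cm vm um m14 m19 m15 m16 m17 m22}m {}t [cm vm um m14 [m19 m15 m16 m17]].
  apply: runs_block => //= z1.
  rewrite (core1 cm) (core2 cm) (uctx10 um) (uctx18 um) (uctx20 um) (uctx21 um) m19.
  move=> G1 z2 G2 z3 G3 z4 G4 z5 G5; split.
  - by do !apply: core_upd => //.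
  - by do !apply: vctx_upd => //.
  - by split=> /=; lia.
  - by [].
  by split=> //=; rewrite ?m17 //; lia.
apply: runs_unless => // [|m22pos]; last first.
  have -> : arc v u = false by move: m22pos; rewrite m22 F9; case: (arc v u).
  by split=> //; rewrite ?muln0 ?addn0.
rewrite m22 F9 => nvu; have {nvu} -> : arc v u by move: nvu; case: (arc v u).
apply: (@runs_seq 3) => //; apply: runs_block => //= z1.
rewrite m15 (core4 cm) => G1 z2; rewrite (uctx20 um) /= (core_col cm) (core1 cm).
move=> G2 z3 G3.
set m' := upd _ _ _.
have cm' : core B D m' by do !apply: core_upd => //.
have vm' : vctx r v m' by do !apply: vctx_upd => //.
have um' : uctx v u m' by do !apply: uctx_upd => //.
have [e14 e15 e16 e17 e19] :
    [/\ m' 14 = c, m' 15 = z1, m' 16 = y, m' 17 = y8 & m' 19 = m 19] by [].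
have e23 : m' 23 = (u \notin B) by rewrite /m' /= G3 G2; case: (u \in B).
move: m' cm' vm' um' e14 e15 e16 e17 e19 e23 => m' cm' vm' um' e14 e15 e16 e17 e19 e23.
apply: runs_unless => //; rewrite e23; case: (u \in B) => //= _.
  apply: runs_block => //= z4; rewrite e16 (core5 cm') => G4; split.
  - by do !apply: core_upd => //.
  - by do !apply: vctx_upd => //.
  - by do !apply: uctx_upd => //.
  - by [].
  by rewrite /= e15 e17 e19 !muln1; split.
by rewrite e15 e16 e17 e19 muln1 muln0 addn0; split.
Qed.

Lemma survey_runs B D r v c m t :
  core B D m -> vctx r v m -> m 14 = c ->
  runs survey m t (30 * n + 8) (fun m t =>
    [/\ core B D m, vctx r v m, m 14 = c &
    [/\ m 15 = a * #|out_nbhd arc v|, m 16 = b * #|out_nbhd arc v :&: B| &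
        m 17 = #|open_nbrs arc D v|]]).
Proof.
move=> cm vm m14.
apply: (@runs_seq 8); first exact: leq_addl.
apply: runs_block => //= x1.
rewrite (core0 cm) (core2 cm) (core6 cm) (vctx11 vm) (vctx12 vm).
rewrite !addn0 => E1 x2 E2 x3 E3 x4 E4.
apply: (@runs_dowhile n 29 (fun i m t =>
    [/\ core B D m, vctx r v m, uctx v i m, m 14 = c &
    [/\ m 19 = 30 + n + i * n + v, m 15 = a * count_below (arc v) i,
        m 16 = b * count_below [pred u | arc v u && (u \in B)] i &
        m 17 = count_below [pred u | (u \notin D) && underlying arc v u] i]])) => //.
- by rewrite addnK mulnC.
- split.
  + by do !apply: core_upd => //.
  + by do !apply: vctx_upd => //.
  + by split=> /=; rewrite ?addn0 ?subn0.
  + by [].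
  by rewrite !count_below0 !muln0 mul0n addn0; split.
- move=> i {x1 E1 x2 E2 x3 E3 x4 E4 cm vm m14}m {}t lti.
  have [u ->] : exists u : 'I_n, i = u by exists (Ordinal lti).
  case=> cm vm um m14 [m19 m15 m16 m17].
  apply: runs_weaken (survey_step_runs _ cm vm um m14 m19 m15 m16 m17).
  move=> {cm vm um m14 m19 m15 m16 m17}m {}t [cm vm um m14 [m19 m15 m16 m17]].
  split; last exact: uctx10 um.
  by rewrite !count_belowS !mulnDr; split.
move=> {x1 E1 x2 E2 x3 E3 x4 E4 cm vm m14}m {}t [cm vm _ m14 [_ m15 m16 m17]].
split=> //; rewrite m15 m16 m17 !count_belown; split=> //.
- by congr (b * _); apply: eq_card => u; rewrite !inE.
- by apply: eq_card => u; rewrite !inE.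
Qed.

(** The vertices treated before iteration [i]: in the first pass the open ones below [i]; in the
    second pass all open ones, inherited from the first, and every vertex below [i]. *)
Definition covered (F : bool) D i : pred 'I_n := fun u =>
  if F then (u < i) || (u \notin D) else (u < i) && (u \notin D).

Record recolor_inv F D r v i B c m : Prop := RecolorInv {
  rec_core : core B D m; rec_vctx : vctx r v m; rec_14 : m 14 = c;
  rec_15 : m 15 = a * #|out_nbhd arc v|;
  rec_16 : m 16 = b * #|out_nbhd arc v :&: B|;
  rec_25 : m 25 = F;
  rec_greedy : greedy_inv arc a b B0 B D c;
  rec_covered : forall u, arc v u -> covered F D i u ->
    sat arc a b B v || (u \in B) }.

Lemma recolor_inv_upd F D r v i B c m j x :
  (j == 10) || (16 < j < 25) -> recolor_inv F D r v i B c m ->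
  recolor_inv F D r v i B c (upd m j x).
Proof.
move=> jlt [*]; split=> //; try by rewrite upd_ne //; lia.
  by apply: core_upd => //; lia.
by apply: vctx_upd => //; lia.
Qed.

Lemma coveredS F D (u w : 'I_n) : covered F D u.+1 w ->
  covered F D u w \/ w = u /\ (F || (u \notin D)).
Proof.
rewrite /covered ltnS leq_eqVlt; have [/val_inj->|_] := eqVneq (w : nat) u.
  by case: F => /=; [right | move=> ->; right].
by left.
Qed.

Lemma recolor_step_runs F D r v u B c m t :
  v \notin D -> #|open_nbrs arc D v| <= 1 ->
  recolor_inv F D r v u B c m -> uctx v u m ->
  runs recolor_step m t 24 (fun m t =>
    uctx v u.+1 m /\ exists B c, recolor_inv F D r v u.+1 B c m).
Proof.
move=> vD leafv inv um; have cm := rec_core inv.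
apply: (@runs_seq 10) => //; apply: runs_block => //=.
move=> y1; rewrite (uctx18 um) (core_arc cm) => F1.
move=> y2; rewrite (core1 cm) => F2.
move=> y3; rewrite (uctx20 um) /= (core_col cm) => F3 y4 F4.
move=> y5; rewrite (uctx21 um) /= (core_done cm) => F5.
move=> y6; rewrite (rec_25 inv) => F6 y7 F7.
move=> y8; rewrite (rec_15 inv) (rec_16 inv) => F8 y9 F9 y10 F10.
have {F1 F2 F3 F4 F5 F6 F7 F8 F9}F10 : (y10 == 0) =
    [&& arc v u, u \notin B, F || (u \notin D) & ~~ sat arc a b B v].
  rewrite F10 F9 F8 F7 F6 F5 F4 F3 F2 F1 /sat -ltnNge.
  rewrite !addn_eq0 !subn_eq0 subn_gt0.
  by case: (arc v u); case: (u \in B); case: (F); case: (u \in D).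
set m' := upd _ _ _.
have inv' : recolor_inv F D r v u B c m' by do !apply: recolor_inv_upd => //.
have um' : uctx v u m' by do !apply: uctx_upd => //.
have m22 : m' 22 = y10 by [].
move: (m') inv' um' m22 => {inv um cm m'}m inv um m22.
apply: (@runs_seq 10) => //.
apply: (@runs_weaken _ _ _ _ (fun m t =>
    uctx v u m /\ exists B c, recolor_inv F D r v u.+1 B c m)).
  move=> {inv um m22 B c F10}m {}t [um [B [c inv]]].
  apply: runs_block => //= z1; rewrite (core1 (rec_core inv)).
  rewrite (uctx10 um) (uctx18 um) (uctx20 um) (uctx21 um).
  move=> G1 z2 G2 z3 G3 z4 G4; split; first by split=> /=; lia.
  by exists B, c; do !apply: recolor_inv_upd => //.
apply: runs_unless => //; rewrite m22; last first.
  rewrite lt0n F10 => ncond; split=> //; exists B, c; case: inv => *; split=> //.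
  move=> w vw /coveredS[|[wu Fu]]; first by auto.
  by move: ncond; rewrite -wu vw wu Fu /= -wu; case: (w \in B); case: sat.
move/eqP; rewrite F10 => /and4P[vu uB Fu nsat].
case: inv => cm vm m14 m15 m16 m25 gi cov.
apply: runs_block => //= x1 x2; rewrite (uctx20 um) => E1.
rewrite {}E1 (core1 cm) => -> x3 E3 x4 E4 {x1 x2}.
have sBu : B \subset u |: B by apply: subsetUr.
have un := ltn_ord u.
have cm' := core_color u cm.
have vm' : vctx r v (upd m (30 + u) 1) by case: vm => *; split.
have um' : uctx v u (upd m (30 + u) 1) by case: um => *; split.
split; first by do !apply: uctx_upd => //.
exists (u |: B), c.+1; split=> //=.
- by do !apply: core_upd => //.
- by do !apply: vctx_upd => //.
- by rewrite E4 m14 addn1.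
- have uo : [set u] \subset out_nbhd arc v by rewrite sub1set inE.
  rewrite E3 /= m16 (core5 cm) setIUr (setIidPr uo).
  by rewrite cardsU1 !inE (negPf uB) andbF mulnDr muln1 addnC.
(* An eliminated [u] is recolored only in the second pass, where [covered] includes all open
   vertices; as [v] is unsatisfied, its open outneighbors are blue. *)
- apply: (greedy_recolor gi vD leafv nsat vu uB) => uD w wD vw.
  have := cov w vw; rewrite (negPf nsat) /=; apply.
  by move: Fu; rewrite uD orbF /covered => ->; rewrite wD orbT.
move=> w vw /coveredS[|[-> _]]; last by rewrite !inE eqxx orbT.
move/(cov w vw)/orP=> [/(satS sBu)->|wB] //.
by rewrite !inE wB !orbT.
Qed.

Lemma recolor_runs F D r v B c m t :
  v \notin D -> #|open_nbrs arc D v| <= 1 ->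
  recolor_inv F D r v 0 B c m ->
  runs recolor m t (25 * n + 4) (fun m t =>
    exists B c, recolor_inv F D r v n B c m).
Proof.
move=> vD leafv inv; apply: (@runs_seq 4); first exact: leq_addl.
have [cm vm] := (rec_core inv, rec_vctx inv); apply: runs_block => //= x1.
rewrite (core0 cm) (core2 cm) (core6 cm) (vctx11 vm).
rewrite !addn0 => E1 x2 E2 x3 E3.
apply: (@runs_dowhile n 24 (fun i m t =>
    uctx v i m /\ exists B c, recolor_inv F D r v i B c m)) => //.
- by rewrite addnK mulnC.
- split; first by split=> /=; rewrite ?addn0 ?subn0.
  by exists B, c; do !apply: recolor_inv_upd => //.
- move=> i {x1 E1 x2 E2 x3 E3 inv cm vm B c}m {}t lti.
  have [u ->] : exists u : 'I_n, i = u by exists (Ordinal lti).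
  case=> um [B [c inv]].
  apply: runs_weaken (recolor_step_runs _ vD leafv inv um).
  by move=> m' t' [um' inv']; split; last exact: uctx10 um'.
by move=> m' t' [].
Qed.

(** Were [v] unsatisfied after both passes, all its outneighbors would be blue, and then a <= b,
    that is p <= 1, satisfies it. *)
Lemma covered_sat D B v :
  (forall u, arc v u -> covered true D n u -> sat arc a b B v || (u \in B)) ->
  sat arc a b B v.
Proof.
move=> cov; have [//|nsat] := boolP (sat arc a b B v).
suff vB : out_nbhd arc v :&: B = out_nbhd arc v.
  by move: nsat; rewrite /sat vB leq_mul2r le_ab orbT.
apply/setIidPl/subsetP=> u; rewrite inE => /cov.
by rewrite /covered ltn_ord (negPf nsat); apply.
Qed.

(** [D0] is the set eliminated before the round. [round_closed] refers to it, and not to the growing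
    [D], to be confronted with a leaf present at the start. *)
Record round_inv D0 r (i : nat) B D c m : Prop := RoundInv {
  round_core : core B D m; round_vctx : vctx r i m; round_14 : m 14 = c;
  round_greedy : greedy_inv arc a b B0 B D c;
  round_sub : D0 \subset D;
  round_closed : forall v, v < i -> v \notin D -> 1 < #|open_nbrs arc D0 v| }.

Lemma visit_runs D0 r v B D c m t :
  round_inv D0 r v B D c m ->
  runs visit m t (80 * n + 27) (fun m t =>
    exists B D c, round_inv D0 r v.+1 B D c m).
Proof.
case=> cm vm m14 gi sD closed.
apply: (@runs_seq (30 * n + 8)); first lia.
apply: runs_weaken (survey_runs _ cm vm m14).
move=> {cm vm m14}m {}t [cm vm m14 [m15 m16 m17]].
apply: (@runs_seq 3); first lia.
apply: runs_block => //= x1; rewrite (vctx13 vm) (core_done cm) (core1 cm) m17.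
move=> E1 x2 E2 x3 E3.
have {E1 E2}E3 : (x3 == 0) = (v \notin D) && (#|open_nbrs arc D v| <= 1).
  by rewrite E3 E2 E1 addn_eq0 subn_eq0 eqb0.
set m' := upd _ _ _.
have cm' : core B D m' by do !apply: core_upd => //.
have vm' : vctx r v m' by do !apply: vctx_upd => //.
have e22 : m' 22 = x3 by [].
move: (m') cm' vm' e22 (erefl : m' 14 = m 14) (erefl : m' 15 = m 15)
  (erefl : m' 16 = m 16).
rewrite m14 m15 m16 => {cm vm m14 m15 m16 m17 m'}m cm vm m22 m14 m15 m16.
apply: (@runs_seq (50 * n + 12)); first lia.
apply: (@runs_weaken _ _ _ _ (fun m t =>
  exists B D c, [/\ core B D m, vctx r v m, m 14 = c,
    greedy_inv arc a b B0 B D c & D0 \subset D /\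
    forall u, u < v.+1 -> u \notin D -> 1 < #|open_nbrs arc D0 u|])).
  move=> {cm vm m22 m14 m15 m16 x3 E3 B D c gi sD closed x1 x2}m {}t.
  move=> [B [D [c [cm vm m14 gi [sD closed]]]]].
  apply: runs_block => /=; first lia.
  move=> z1; rewrite (core1 cm) (core2 cm).
  rewrite (vctx9 vm) (vctx11 vm) (vctx12 vm) (vctx13 vm).
  move=> G1 z2 G2 z3 G3 z4 G4.
  exists B, D, c; split=> //.
    by do !apply: core_upd => //.
  by case: vm => *; split=> //=; lia.
apply: runs_unless => //; first by lia.
  rewrite m22 => /eqP; rewrite E3 => /andP[vD leafv].
  apply: (@runs_seq 1) => //; first lia.
  apply: runs_block => //=.
  apply: (@runs_seq (25 * n + 4)); first lia.
  have inv : recolor_inv false D r v 0 B c (upd m 25 0).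
    by split=> //; [apply: core_upd | apply: vctx_upd].
  apply: runs_weaken (recolor_runs _ vD leafv inv).
  move=> {inv cm vm m14 m15 m16 m22 gi B c}m {}t [B [c inv]].
  apply: (@runs_seq 1); first lia.
  apply: runs_block => //=.
  apply: (@runs_seq (25 * n + 4)); first lia.
  (* The first pass has treated all open vertices, which is what the second pass assumes at its
     start. *)
  have {}inv : recolor_inv true D r v 0 B c (upd m 25 1).
    case: inv => cm vm m14 m15 m16 m25 gi cov.
    split=> //; [exact: core_upd | exact: vctx_upd |].
    by move=> u vu; rewrite /covered ltn0 /= => uD; apply: cov; rewrite // /covered ltn_ord.
  apply: runs_weaken (recolor_runs _ vD leafv inv).
  move=> {inv B c}m {}t [B [c [cm vm m14 m15 m16 m25 gi cov]]].
  apply: runs_block => /=; first lia.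
  move=> y x; rewrite (vctx13 vm) (core1 cm) => -> ->.
  exists B, (v |: D), c; split=> //.
  - exact: core_flag.
  - by case: vm => *; split.
  - exact: greedy_close gi (covered_sat cov) leafv.
  split; first exact: subset_trans sD (subsetUr _ _).
  move=> u; rewrite ltnS leq_eqVlt !inE val_eqE => /orP[->//|uv].
  by rewrite negb_or => /andP[_]; apply: closed.
rewrite m22 lt0n E3 => nleaf; exists B, D, c; split=> //; split=> // u.
rewrite ltnS leq_eqVlt val_eqE => /orP[/eqP->|]; last exact: closed.
move=> vD; move: nleaf; rewrite vD -ltnNge => /leq_trans; apply.
exact: open_nbrsS.
Qed.

Lemma round_runs (j : nat) B D c m t :
  core B D m -> m 14 = c -> greedy_inv arc a b B0 B D c ->
  m 8 = n - j -> j < n -> j <= #|D| ->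
  runs round m t (n * (80 * n + 28) + 5) (fun m t =>
    m 8 = n - j.+1 /\ exists B D c,
      [/\ core B D m, m 14 = c, greedy_inv arc a b B0 B D c & j < #|D|]).
Proof.
move=> cm m14 gi m8 ltjn lejD.
apply: (@runs_seq 4); first lia.
apply: runs_block => //= x1.
rewrite (core0 cm) (core2 cm) (core6 cm) (core7 cm) !addn0 => E1 x2 E2 x3 E3 x4 E4.
apply: (@runs_seq (n * (80 * n + 28))); first lia.
apply: (@runs_dowhile n (80 * n + 27) (fun i m t =>
  exists B' D' c, round_inv D (n - j) i B' D' c m)) => //.
- lia.
- exists B, D, c; split=> //; first by do !apply: core_upd => //.
  by split=> //=; lia.
- move=> i {x1 E1 x2 E2 x3 E3 x4 E4 cm m14 m8}m {}t lti.
  have [u ->] : exists u : 'I_n, i = u by exists (Ordinal lti).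
  case=> [B' [D' [c' inv]]].
  apply: runs_weaken (visit_runs _ inv).
  move=> {inv}m' t' [B1 [D1 [c1 inv]]]; split; first by exists B1, D1, c1.
  exact: vctx9 (round_vctx inv).
move=> {x1 E1 x2 E2 x3 E3 x4 E4 cm m14 m8 gi}m {}t [B' [D' [c' inv]]].
case: inv => cm vm m14 gi sD closed.
apply: runs_block => /=; first lia.
move=> x1; rewrite (vctx8 vm) (core1 cm) => E1; split; first lia.
exists B', D', c'; split=> //; first by apply: core_upd.
(* Progress: a leaf of the open part at the start of the round cannot stay open, so the eliminated
   set grows unless it was already everything. *)
have [/eqP DT|nDT] := boolP (~: D == set0).
  suff -> : D' = setT by rewrite cardsT card_ord.
  by apply/eqP; rewrite -subTset -[setT](_ : D = _) // -(setCK D) DT setC0.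
have [v vD leafv] := tree_has_leaf arc_tree nDT.
apply: leq_ltn_trans lejD (proper_card _); apply/properP; split=> //.
exists v; last by rewrite inE in vD.
apply: contraT => vD'; have := closed v (ltn_ord v) vD'.
by rewrite ltnNge leafv.
Qed.

(** * Reading the input *)

Variable L : seq nat.
Hypothesis L_col : forall u, nth 0 L u = (u \in B0).
Hypothesis L_arc : forall v u, nth 0 L (n + v * n + u) = arc v u.

(** The zeros past the numbers read so far matter: they become the flags of the eliminated vertices,
    of which there are none at first. *)
Record read_inv (s : nat) m t : Prop := ReadInv {
  read0 : m 0 = 0; read1 : m 1 = 1; read2 : m 2 = n; read3 : m 3 = k;
  read4 : m 4 = a; read5 : m 5 = b; read6 : m 6 = 30 + s; read14 : m 14 = 0;
  read_tape : t = drop s L;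
  read_mem : forall x, m (30 + x) = if x < s then nth 0 L x else 0 }.

Lemma read_inv_upd s m t j x : 6 < j < 14 -> read_inv s m t ->
  read_inv s (upd m j x) t.
Proof. by move=> jlt [*]; split=> // *; rewrite upd_ne //; lia. Qed.

Lemma read_inv_store s m t : read_inv s m t ->
  read_inv s.+1 (upd (upd m (30 + s) (head 0 t)) 6 (30 + s.+1)) (behead t).
Proof.
case=> ? ? ? ? ? ? ? ? tE mem; split=> //.
  by rewrite tE -drop1 drop_drop.
move=> x /=; rewrite eqn_add2l ltnS leq_eqVlt mem tE.
by have [->|//] := eqVneq x s; rewrite -nth0 nth_drop addn0.
Qed.

Lemma read_input_runs :
  runs read_input (fun=> 0) ([:: n; k; a; b] ++ L) (n.+1 * (5 * n + 3) + 9)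
    (fun m t => core B0 set0 m /\ m 14 = 0).
Proof.
apply: (@runs_seq 7); first lia.
apply: runs_block => //= x1 E1.
apply: (@runs_seq (n.+1 * (5 * n + 3))); first lia.
(* [L] is read in n + 1 blocks of length n: the colors and the n rows of the matrix. *)
apply: (@runs_dowhile n.+1 (5 * n + 2) (fun i m t =>
  read_inv (i * n) m t /\ m 8 = n.+1 - i)) => //.
- lia.
- by split=> /=; [split=> //; rewrite drop0 | lia].
- move=> i m t lti [inv m8]; apply: (@runs_seq 1); first lia.
  apply: runs_block => //= x2; rewrite (read0 inv) (read2 inv) addn0 => E2.
  apply: (@runs_seq (n * 5)); first lia.
  apply: (@runs_dowhile n 4 (fun j m t =>
    [/\ read_inv (i * n + j) m t, m 8 = n.+1 - i & m 9 = n - j])) => //.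
  + by rewrite addn0 subn0; split=> //; apply: read_inv_upd.
  + move=> j {inv m8 x2 E2}m {}t ltj [inv m8 m9].
    apply: runs_block => //= y x; rewrite (read6 inv) => -> -> x3.
    rewrite (read1 inv) m9 /= => E3 x4 E4.
    split; last by rewrite /=; lia.
    split; [|by []|by rewrite /=; lia].
    have -> : x3 = 30 + (i * n + j).+1 by lia.
    rewrite addnS; apply: read_inv_upd => //.
    exact: read_inv_store (read_inv_upd (head 0 t) (isT : 6 < 10 < 14) inv).
  move=> {inv m8 x2 E2}m {}t [inv m8 _].
  apply: runs_block => /=; first lia.
  move=> x2; rewrite (read1 inv) m8 => E2; split; last lia.
  by split; [rewrite mulSn addnC; apply: read_inv_upd | rewrite /=; lia].
move=> m t [inv _]; apply: runs_block => /=; first lia.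
move=> x2; rewrite (read2 inv) => E2.
case: inv => ? ? ? ? ? ? ? ? _ mem; split=> //; split=> //=.
- move=> u; rewrite mem L_col ifT //; have := ltn_ord u; lia.
- move=> v u; rewrite -!addnA mem addnA L_arc ifT //; have := mx_index_lt v u; lia.
- by move=> u; rewrite -!addnA mem inE ifN // -leqNgt mulSn; lia.
Qed.

Lemma difr_cmd_runs :
  runs difr_cmd (fun=> 0) ([:: n; k; a; b] ++ L)
    (n.+1 * (5 * n + 3) + n * (n * (80 * n + 28) + 6) + 12)
    (fun m t => exists B c,
       greedy_inv arc a b B0 B setT c /\ m 0 = (c <= k)).
Proof.
apply: (@runs_seq (n.+1 * (5 * n + 3) + 9)); first lia.
apply: runs_weaken read_input_runs => m t [cm m14].
apply: (@runs_seq 1); first lia.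
apply: runs_block => //= x1; rewrite (core0 cm) (core2 cm) addn0 => E1.
apply: (@runs_seq (n * (n * (80 * n + 28) + 6))); first lia.
apply: (@runs_dowhile n (n * (80 * n + 28) + 5) (fun j m t =>
  m 8 = n - j /\ exists B D c,
    [/\ core B D m, m 14 = c, greedy_inv arc a b B0 B D c & j <= #|D|])) => //.
- lia.
- split; first by rewrite /= subn0.
  exists B0, set0, 0; split=> //; first by apply: core_upd.
  exact: greedy_init.
- move=> j {x1 E1 cm m14}m {}t ltj [m8 [B [D [c [cm m14 gi lejD]]]]].
  apply: runs_weaken (round_runs _ cm m14 gi m8 ltj lejD).
  by move=> m' t' [].
move=> {x1 E1 cm m14}m {}t [_ [B [D [c [cm m14 gi lenD]]]]].
apply: runs_block => /=; first lia.
move=> x1; rewrite (core1 cm) (core3 cm) m14 => E1 x2 E2.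
(* After [n] rounds at least [n] vertices are eliminated. *)
have DT : D = setT.
  by apply/eqP; rewrite eqEcard subsetT cardsT card_ord.
by exists B, c; rewrite -DT; split=> //; rewrite /= E2 E1 -subn_eq0; case: (c - k).
Qed.

End Correctness.

(** * From the structured program to the machine and the time bound *)

Lemma nth_allpairs (S T R : Type) (F : S -> T -> R) (s : seq S) (t : seq T)
    x0 y0 z0 i j : i < size s -> j < size t ->
  nth z0 [seq F x y | x <- s, y <- t] (i * size t + j) =
  F (nth x0 s i) (nth y0 t j).
Proof.
elim: s i => //= x s IHs [|i] lti ltj; rewrite nth_cat size_map.
  by rewrite mul0n add0n ltj (nth_map y0).
by rewrite mulSn -addnA ltnNge leq_addr addKn IHs.
Qed.

(** The program may stop before [T]; a halted configuration is a fixed point, so it is still there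
    after [T] steps. *)
Lemma runs_decides c input T (Q : assertion) A :
  runs c (fun=> 0) input T Q ->
  (forall m t, Q m t -> A /\ m 0 = 1 \/ ~ A /\ m 0 = 0) ->
  decides_within (compile 0 c) input T A.
Proof.
have cP : code_at (compile 0 c) 0 (compile 0 c).
  by exists [::], [::]; rewrite cats0.
move=> /(_ _ _ cP)[T' [m [t [leT itT Qm]]]] QA.
rewrite /decides_within -(subnK leT) iterD /init itT add0n.
have halt d : iter d (step (compile 0 c)) (Config (size (compile 0 c)) m t) =
    Config (size (compile 0 c)) m t.
  by elim: d => //= d ->; rewrite /step /= onth_default.
by rewrite halt /halted /= leqnn; split=> //; apply: QA Qm.
Qed.

Theorem theorem3 :
  exists (P : program) (T : nat -> nat),
    bigO T (fun n => n ^ 4) /\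
    forall (n : nat) (arc : rel 'I_n) (f : {ffun 'I_n -> color})
           (k : nat) (p : rat),
      (0 <= p <= 1)%R ->
      directed_tree arc ->
      decides_within P (encode arc f k p) (T n) (Difr arc f k p).
Proof.
exists (compile 0 difr_cmd), (fun n =>
  n.+1 * (5 * n + 3) + n * (n * (80 * n + 28) + 6) + 12); split.
  (* The bound expands to 80 n^3 + 33 n^2 + 14 n + 15, and 142 is the sum of these coefficients. *)
  exists 142, 1 => n n1; rewrite !expnS expn0 muln1.
  have n2 : n <= n * n by rewrite leq_pmulr.
  have n3 : n * n <= n * (n * n) by rewrite leq_pmull.
  have n4 : n * (n * n) <= n * (n * (n * n)) by rewrite leq_pmull.
  nia.
move=> n arc f k p p01 tree.
have n0 : 0 < n by case: tree => [n0 _ _ _]; rewrite card_ord in n0.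
pose B0 := [set v | f v == Blue].
have enumn (u : 'I_n) : nth u (enum 'I_n) u = u by rewrite nth_ord_enum.
have szn : size (enum 'I_n) = n by rewrite size_enum_ord.
apply: (runs_decides (@difr_cmd_runs n arc k _ _ B0 n0 (num_le_den p01) tree _ _ _)).
- by move=> u; rewrite nth_cat size_map szn ltn_ord (nth_map u) ?szn // enumn inE.
- move=> v u; rewrite nth_cat size_map szn -addnA ltnNge leq_addr /= addKn.
  have := @nth_allpairs _ _ _ (fun u v => nat_of_bool (arc u v))
            (enum 'I_n) (enum 'I_n) v u 0 v u.
  by rewrite szn !enumn; apply.
move=> m t [B [c [gi ->]]]; have dec := greedy_decides p01 k gi.
by case: (leqP c k) dec => /= _ [DA AD]; [left | right]; split; auto.
Qed.
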